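(* Let $\Omega\subset\mathcal{F}$ be a disk, and let $(f_n)_{n\ge1}$ be maps $f_n:\Omega\to\mathcal{F}$ such that each $f_n$ is scaling with scaling ratio $q^{\lambda_n}$, $\lambda_n\in\mathbb{Z}$. Suppose (a) $q^{\lambda_n}\ge \operatorname{diam}(\Omega)^{-1}$ for all $n\ge1$; (b) $\sum_{N=1}^{\infty}\frac{\#K_N}{N^3}<\infty$, where $K_N=\{(n,m):1\le n,m\le N,\ \lambda_n=\lambda_m\}$. Then for Haar-almost every $x\in\Omega$, the sequence $([f_n(x)])_{n\ge1}$ is uniformly distributed in $\mathcal{O}$.
   Context: $\mathcal{F}$ is a non-Archimedean local field with valuation ring $\mathcal{O}$, maximal ideal $\mathfrak{p}$, $q=\#\mathcal{O}/\mathfrak{p}$, normalized absolute value $|\cdot|_\mathfrak{p}$ and prime element $\pi$. Fix representatives $C\subset\mathcal{O}$ of $\mathcal{O}/\mathfrak{p}$ with $0\in C$; writing $x=\sum_{n\ge v}c_n\pi^n$ ($c_n\in C$), the integral part is $[x]=\sum_{n\ge0}c_n\pi^n$. A disk is a set $D(a,q^k)=\{x:|x-a|_\mathfrak{p}\le q^k\}$, $k\in\mathbb{Z}$; its diameter is $q^k$. A map $f:\Omega\to\mathcal{F}$ is scaling with scaling ratio $q^\lambda$ ($\lambda\in\mathbb{Z}$) if $|f(x)-f(y)|_\mathfrak{p}=q^\lambda|x-y|_\mathfrak{p}$ for all $x,y\in\Omega$. Haar measure is normalized so $\mu(\mathcal{O})=1$. A sequence $(x_n)\subset\mathcal{O}$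 is uniformly distributed in $\mathcal{O}$ if for all $a\in\mathcal{O}$, $k\in\mathbb{N}$, $\frac1N\#\{1\le n\le N:x_n\in D(a,q^{-k})\}\to q^{-k}$. *)

(* Defs.v *)
From HB Require Import structures.
From mathcomp Require Import all_boot all_order all_algebra.
From mathcomp Require Import all_classical all_reals all_analysis.
From Stdlib Require Import ClassicalEpsilon.
Set Implicit Arguments. Unset Strict Implicit. Unset Printing Implicit Defensive.
Import Order.TTheory GRing.Theory Num.Theory.
Import numFieldNormedType.Exports.
Local Open Scope ring_scope.
Local Open Scope classical_set_scope.

(* A field F, viewed as a pointed type (point 0) so that it can carry a
   sigma-algebra. *)
Definition ptF (F : fieldType) : Type := F.
HB.instance Definition _ (F : fieldType) := Choice.on (ptF F).
HB.instance Definition _ (F : fieldType) := isPointed.Build (ptF F) (0 : F).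

Section LocalField.
Variables (R : realType) (F : fieldType) (absv : F -> R).

Definition disk (a : F) (r : R) : set F := [set x | absv (x - a) <= r].

Definition abs_cauchy (u : nat -> F) : Prop :=
  forall e : R, 0 < e -> exists N : nat, forall m n : nat,
    (N <= m)%N -> (N <= n)%N -> absv (u n - u m) < e.
Definition abs_cvg (u : nat -> F) (l : F) : Prop :=
  (fun n => absv (u n - l)) @ \oo --> (0 : R).

(* F is a non-Archimedean local field with normalized absolute value absv,
   residue field of cardinality q, prime element pi, and C a system of
   representatives of O/p containing 0.  (Local field = field complete w.r.t.
   a non-trivial discrete absolute value with finite residue field.) *)
Definition abs_value_axioms : Prop :=
  [/\ (forall x, absv x = 0 <-> x = 0),
      (forall x y, absv (x * y) = absv x * absv y) &
      (forall x y, absv (x + y) <= Num.max (absv x) (absv y))].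

Definition residue_reps (q : nat) (C : seq F) : Prop :=
  [/\ uniq C /\ size C = q, (0 : F) \in C,
      (forall c, c \in C -> absv c <= 1),
      (forall c c', c \in C -> c' \in C -> c != c' -> ~ (absv (c - c') < 1)) &
      (forall x, absv x <= 1 -> exists2 c, c \in C & absv (x - c) < 1)].

Definition nonarch_local_field (pi : F) (q : nat) (C : seq F) : Prop :=
  [/\ abs_value_axioms,
      (1 < q)%N /\ (forall x, x != 0 -> exists k : int, absv x = (q%:R) ^ k),
      absv pi = (q%:R)^-1,
      residue_reps q C &
      (forall u, abs_cauchy u -> exists l, abs_cvg u l)].

(* The collection of all disks D(a, q^k), k in Z; it generates the Borel
   sigma-algebra of F. *)
Definition disks (q : nat) : set (set (ptF F)) :=
  [set D | exists (a : F) (k : int), D = disk a ((q%:R) ^ k)].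

Definition pi_expansion (pi : F) (C : seq F) (x : F) (v : int) (c : nat -> F)
  : Prop :=
  (forall i, c i \in C) /\
  abs_cvg (fun M => \sum_(i < M) c i * pi ^ (v + i%:Z)) x.

(* y = [x] = sum_{n >= 0} c_n pi^n = x - sum_{v <= n < 0} c_n pi^n *)
Definition is_intpart (pi : F) (C : seq F) (x y : F) : Prop :=
  exists (v : int) (c : nat -> F), pi_expansion pi C x v c /\
    y = x - \sum_(i < `|v|%N | v + i%:Z < 0) c i * pi ^ (v + i%:Z).

Definition intpart (pi : F) (C : seq F) (x : F) : F :=
  epsilon (inhabits (0 : F)) (is_intpart pi C x).

Definition unif_distr_O (q : nat) (s : nat -> F) : Prop :=
  forall (a : F) (k : nat), absv a <= 1 ->
    (fun N : nat =>
       (#|[set n : 'I_N.+1 | (0 < val n)%N &&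
            (absv (s (val n) - a) <= (q%:R) ^- k)]|)%:R / (N%:R : R))
      @ \oo --> ((q%:R : R) ^- k).

Definition scaling_on (Omega : set F) (q : nat) (lam : int) (f : F -> F) : Prop :=
  forall x y, Omega x -> Omega y ->
    absv (f x - f y) = (q%:R) ^ lam * absv (x - y).

End LocalField.

Definition card_K (lam : nat -> int) (N : nat) : nat :=
  #|[set p : 'I_N.+1 * 'I_N.+1 | [&& (0 < val p.1)%N, (0 < val p.2)%N &
                                    lam (val p.1) == lam (val p.2)]]|.

(* Main.v *)
(* Write 1_j for the indicator of |[f_n(x)] - a| <= q^-j and put
   X_n = 1_(j+1) - q^-1 1_j.  The q children of a disk of radius q^(-lam_n-j)
   are mapped by f_n into different residue classes, hence into all of them
   (pigeonhole).  So X_n has mean zero on each disk of radius q^(-lam_n-j),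
   while it is constant on each disk of radius q^(-lam_n-j-1).  Hence X_n and
   X_m are orthogonal as soon as lam_n and lam_m differ, and the integral of
   (X_1 + ... + X_N)^2 is at most mu(Omega) #K_N.  By monotone convergence the
   series of (X_1 + ... + X_N)^2 / N^3 is finite almost everywhere, which for
   bounded X_n forces the averages to tend to 0 (Davenport, Erdos, LeVeque);
   the frequencies of all disks then follow by induction on j. *)

Require Import Defs.
From HB Require Import structures.
From mathcomp Require Import all_boot all_order all_algebra.
From mathcomp Require Import all_classical all_reals all_analysis.
From mathcomp Require Import measurable_realfun.
From mathcomp Require Import ring lra zify.
Import Order.TTheory GRing.Theory Num.Theory.
Import numFieldNormedType.Exports.
Local Open Scope ring_scope.
Local Open Scope classical_set_scope.
Set Implicit Arguments. Unset Strict Implicit. Unset Printing Implicit Defensive.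

(** * Averages controlled by a summable series of squares *)

(* [|s k| >= e N / 2] on a block of [e N / 2] consecutive indices after [N]. *)
Lemma avg_block (R : realType) (s : nat -> R) (e : R) (N : nat) :
  (forall n, `|s n.+1 - s n| <= 1) -> 0 < e <= 1 -> (0 < N)%N ->
  e * N%:R <= `|s N| ->
  exists h, e ^+ 3 / 64 <= \sum_(N <= k < N + h) s k ^+ 2 / k%:R ^+ 3.
Proof.
move=> s1 /andP[e0 e1] N0 eN.
have sub i : `|s N| - i%:R <= `|s (N + i)%N|.
  elim: i => [|i IH]; first by rewrite addn0 subr0.
  rewrite addnS -natr1; have := s1 (N + i)%N.
  have := ler_normB (s (N + i).+1) (s (N + i).+1 - s (N + i)%N).
  rewrite subKr; move: IH; lra.
have n0 : 0 < N%:R :> R by rewrite ltr0n.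
set x := e * N%:R / 2.
have xx : x + x = e * N%:R by rewrite /x -splitr.
have x0 : 0 < x by rewrite divr_gt0 ?mulr_gt0.
have /andP[t1 t2] := truncn_itv (ltW x0).
set t := Num.trunc x in t1 t2.
(* The block has more than [x] terms and, as [x <= N], each [k] in it is at most [2 * N]. The total
   is thus at least [x ^+ 3 / (8 * N ^+ 3)], which is [e ^+ 3 / 64]. *)
exists t.+1.
have key k : (N <= k < N + t.+1)%N ->
    x ^+ 2 / (8 * N%:R ^+ 3) <= s k ^+ 2 / k%:R ^+ 3.
  move=> /andP[Nk kN]; rewrite -(subnKC Nk); set i := (k - N)%N.
  have it : i%:R <= t%:R :> R by rewrite ler_nat /i; lia.
  have ix := le_trans it t1.
  have xs : x <= `|s (N + i)%N|.
    apply: le_trans (sub i); rewrite lerBrDr.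
    by apply: le_trans eN; rewrite -xx lerD2l.
  have xN : i%:R <= N%:R :> R.
    apply: le_trans ix _; have := ler_piMl (ltW n0) e1; rewrite -xx; lra.
  rewrite -[in leRHS]real_normK ?num_real //; apply: ler_pM.
  - by rewrite exprn_ge0 // ltW.
  - by rewrite invr_ge0 mulr_ge0 // exprn_ge0 // ltW.
  - by rewrite lerXn2r ?nnegrE // ltW.
  - rewrite lef_pV2 ?posrE ?exprn_gt0 ?mulr_gt0 ?exprn_gt0 ?ltr0n
      ?addn_gt0 ?N0 //.
    have -> : 8 * N%:R ^+ 3 = (2 * N%:R) ^+ 3 :> R by ring.
    rewrite lerXn2r ?nnegrE ?mulr_ge0 ?ler0n // natrD; lra.
apply: (@le_trans _ _ (\sum_(N <= k < N + t.+1) x ^+ 2 / (8 * N%:R ^+ 3))).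
  rewrite sumr_const_nat addKn -[leRHS]mulr_natr.
  apply: (@le_trans _ _ (x ^+ 2 / (8 * N%:R ^+ 3) * x)).
    rewrite /x le_eqVlt; apply/orP; left; apply/eqP.
    by field; rewrite gt_eqF.
  apply: ler_wpM2l; last exact: ltW.
  by rewrite divr_ge0 ?exprn_ge0 ?mulr_ge0 ?exprn_ge0 // ltW.
by rewrite big_nat [leRHS]big_nat; apply: ler_sum => k; exact: key.
Qed.

(** If [|s N| >= e * N] for arbitrarily large [N], [avg_block] would bound the tails of the series
    below by a fixed positive constant, whereas the tails of a convergent series tend to 0. *)
Lemma avg_cvg0 (R : realType) (s : nat -> R) :
  (forall n, `|s n.+1 - s n| <= 1) ->
  (\sum_(0 <= N <oo) (s N ^+ 2 / N%:R ^+ 3)%:E < +oo)%E ->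
  (fun N => s N / N%:R) @ \oo --> (0 : R).
Proof.
move=> s1 fin.
have ge0 k : (0 <= (s k ^+ 2 / k%:R ^+ 3)%:E)%E.
  by rewrite lee_fin divr_ge0 ?sqr_ge0 ?exprn_ge0.
have tail := nneseries_tail_cvg fin (fun k _ => ge0 k).
(* Capping at 1 meets the requirement [e <= 1] of [avg_block]. *)
apply/cvgr0Pnorm_le => e0 e0_gt0; pose e := Num.min e0 1.
have e_itv : 0 < e <= 1 by rewrite lt_min ge_min e0_gt0 ltr01 lexx orbT.
have /andP[e_gt0 _] := e_itv.
have d0 : (0 < (e ^+ 3 / 64)%:E)%E by rewrite lte_fin divr_gt0 ?exprn_gt0.
have : \forall N \near \oo,
    (\sum_(N <= k <oo) (s k ^+ 2 / k%:R ^+ 3)%:E < (e ^+ 3 / 64)%:E)%E.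
  exact: tail (open_ereal_lt' d0).
move=> small; near=> N.
have N0 : (0 < N)%N by near: N; exact: nbhs_infty_gt.
apply: (@le_trans _ _ e); last by rewrite ge_min lexx.
rewrite normrM normfV normr_nat ler_pdivrMr ?ltr0n // leNgt.
apply/negP => /ltW /(avg_block s1 e_itv N0)[h].
rewrite leNgt => /negP; apply; rewrite -lte_fin.
apply: (@le_lt_trans _ _ (\sum_(N <= k <oo) (s k ^+ 2 / k%:R ^+ 3)%:E)%E);
  last by near: N; exact: small.
rewrite -sumEFin; apply: nneseries_lim_ge => k _ _; exact: ge0.
Unshelve. all: by end_near.
Qed.

(** * Almost everywhere convergence from a variance bound *)

Lemma bounded_integrable d (T : measurableType d) (R : realType)
  (mu : {measure set T -> \bar R}) (D : set T) (g : T -> R) (B : R) :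
  measurable D -> (mu D < +oo)%E -> measurable_fun D g ->
  (forall x, `|g x| <= B) -> mu.-integrable D (EFin \o g).
Proof.
move=> mD fD mg gB; apply: measurable_bounded_integrable => //.
exists B; split; first exact: num_real.
by move=> M BM x _; apply: le_trans (gB x) (ltW BM).
Qed.

(** Integrating the series of the [h N] term by term bounds its integral by [M] times a convergent
    series, so it is finite almost everywhere. Since [|X n x| <= 1], the partial sums move by at
    most 1 and [avg_cvg0] applies pointwise. *)
Lemma ae_avg_cvg0 d (T : measurableType d) (R : realType)
  (mu : {measure set T -> \bar R}) (D : set T) (X : nat -> T -> R)
  (K : nat -> nat) (M : R) : measurable D -> 0 <= M ->
  (forall n, measurable_fun D (X n)) -> (forall n x, `|X n x| <= 1) ->
  (forall N, (\int[mu]_(x in D) ((\sum_(1 <= n < N.+1) X n x) ^+ 2)%:E <=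
     (M * (K N)%:R)%:E)%E) ->
  (\sum_(0 <= N <oo) ((K N)%:R / N%:R ^+ 3 : R)%:E < +oo)%E ->
  {ae mu, forall x, D x ->
    (fun N => (\sum_(1 <= n < N.+1) X n x) / N%:R) @ \oo --> (0 : R)}.
Proof.
move=> mD M0 mX X1 var fin.
pose h N x := ((\sum_(1 <= n < N.+1) X n x) ^+ 2 / N%:R ^+ 3).
have h0 N x : (0 <= (h N x)%:E)%E.
  by rewrite lee_fin divr_ge0 ?sqr_ge0 ?exprn_ge0.
have mS N : measurable_fun D (fun x => (\sum_(1 <= n < N.+1) X n x) ^+ 2).
  by apply: measurable_funX; exact: measurable_sum.
have mh N : measurable_fun D (fun x => (h N x)%:E).
  apply/measurable_EFinP; apply: measurable_funM => //.
pose H x := (\sum_(0 <= N <oo) (h N x)%:E)%E.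
have mH : measurable_fun D H.
  by apply: (@ge0_emeasurable_sum _ _ _ _ _ xpredT) => // *; exact: h0.
have intH : (\int[mu]_(x in D) H x < +oo)%E.
  rewrite integral_nneseries //.
  apply: (@le_lt_trans _ _
    (\sum_(0 <= N <oo) (M%:E * ((K N)%:R / N%:R ^+ 3)%:E))%E).
    apply: lee_nneseries => [N _ _|N _]; first by apply: integral_ge0 => *.
    rewrite (_ : (fun x => _) = (fun x => (N%:R ^- 3)%:E *
      ((\sum_(1 <= n < N.+1) X n x) ^+ 2)%:E)%E); last first.
      by apply/funext => x; rewrite -EFinM mulrC.
    rewrite ge0_integralZl_EFin ?invr_ge0 ?exprn_ge0 //.
    - rewrite -EFinM mulrA [X in (_ <= X%:E)%E]mulrC EFinM.
      by apply: lee_wpmul2l => //; rewrite lee_fin invr_ge0 exprn_ge0.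
    - by move=> x _; rewrite lee_fin sqr_ge0.
    - exact/measurable_EFinP.
  rewrite nneseriesZl; last by move=> N _; rewrite lee_fin divr_ge0 ?exprn_ge0.
  by rewrite lte_mul_pinfty ?lee_fin.
have : mu.-integrable D H.
  apply/integrableP; split => //.
  under eq_integral => x _ do rewrite gee0_abs ?nneseries_ge0 //.
  exact: intH.
move/(integrable_ae mD); apply: filterS => x fx Dx.
apply: avg_cvg0 => [n|].
  by rewrite big_nat_recr //= addrAC subrr add0r.
have := fx Dx; rewrite ge0_fin_numE // nneseries_ge0 // => *; exact: h0.
Qed.

(** * Absolute values and digits *)

Section Valuation.
Variables (R : realType) (F : fieldType) (absv : F -> R) (pi : F) (q : nat).
Variable C : seq F.
Hypothesis HF : nonarch_local_field absv pi q C.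
Local Notation Q := (q%:R : R).

Lemma Q_gt1 : 1 < Q.
Proof. by case: HF => _ [q1 _] _ _ _; rewrite ltr1n. Qed.

Lemma Q_gt0 : 0 < Q. Proof. exact: lt_trans ltr01 Q_gt1. Qed.

Lemma Q_neq0 : Q != 0. Proof. by rewrite gt_eqF ?Q_gt0. Qed.

Lemma Qz_gt0 (s : int) : 0 < Q ^ s. Proof. by rewrite exprz_gt0 ?Q_gt0. Qed.

Lemma ler_Qz (s t : int) : (Q ^ s <= Q ^ t) = (s <= t).
Proof. by rewrite (ler_eXz2l Q_gt1). Qed.

Lemma ltr_Qz (s t : int) : (Q ^ s < Q ^ t) = (s < t).
Proof. by rewrite (ltr_eXz2l Q_gt1). Qed.

Lemma abs_eq0 x : (absv x == 0) = (x == 0).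
Proof. by case: HF => -[+ _ _] _ _ _ _ => /(_ x) H; apply/eqP/eqP; move/H. Qed.

Lemma abs0 : absv 0 = 0. Proof. by apply/eqP; rewrite abs_eq0. Qed.

Lemma absM x y : absv (x * y) = absv x * absv y.
Proof. by case: HF => -[]. Qed.

Lemma abs_Qz x : x != 0 -> exists s : int, absv x = Q ^ s.
Proof. by case: HF => _ [_ H] _ _ _; exact: H. Qed.

Lemma abs_ge0 x : 0 <= absv x.
Proof.
have [->|/abs_Qz[s ->]] := eqVneq x 0; first by rewrite abs0.
exact/ltW/Qz_gt0.
Qed.

Lemma abs1 : absv 1 = 1.
Proof.
have n0 : absv 1 != 0 by rewrite abs_eq0 oner_eq0.
by apply: (mulfI n0); rewrite -absM !mulr1.
Qed.

Lemma absN x : absv (- x) = absv x.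
Proof.
rewrite -mulN1r absM; suff -> : absv (-1) = 1 by rewrite mul1r.
have : absv (-1) ^+ 2 = 1 by rewrite expr2 -absM mulrNN mulr1 abs1.
move/eqP; rewrite sqrf_eq1 => /orP[/eqP//|/eqP H].
by have := abs_ge0 (-1); rewrite H oppr_ge0 ler10.
Qed.

Lemma absBC x y : absv (x - y) = absv (y - x).
Proof. by rewrite -absN opprB. Qed.

Lemma absD_le r x y : absv x <= r -> absv y <= r -> absv (x + y) <= r.
Proof.
case: HF => -[_ _ + _] _ _ _ => /(_ x y) H xr yr; apply: le_trans H _.
by rewrite ge_max xr yr.
Qed.

Lemma absB_le r x y : absv x <= r -> absv y <= r -> absv (x - y) <= r.
Proof. by move=> xr yr; apply: absD_le; rewrite ?absN. Qed.

Lemma abs_sum_le r (I : Type) (s : seq I) (P : pred I) (u : I -> F) :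
  0 <= r -> (forall i, P i -> absv (u i) <= r) ->
  absv (\sum_(i <- s | P i) u i) <= r.
Proof.
move=> r0 ur; elim/big_ind: _ => //; first by rewrite abs0.
by move=> x y; exact: absD_le.
Qed.

Lemma abs_pi : absv pi = Q^-1. Proof. by case: HF. Qed.

Lemma pi_neq0 : pi != 0.
Proof. by rewrite -abs_eq0 abs_pi invr_eq0 Q_neq0. Qed.

Lemma absV x : absv x^-1 = (absv x)^-1.
Proof.
have [->|x0] := eqVneq x 0; first by rewrite invr0 abs0 invr0.
have n0 : absv x != 0 by rewrite abs_eq0.
by apply: (mulfI n0); rewrite -absM !divff // abs1.
Qed.

Lemma abs_pi_z (s : int) : absv (pi ^ s) = Q ^ (- s).
Proof.
have Hn (n : nat) : absv (pi ^+ n) = Q ^- n.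
  elim: n => [|n IH]; first by rewrite !expr0 abs1 invr1.
  by rewrite !exprS absM IH abs_pi invfM.
case: s => n; first by rewrite -exprnN -exprnP Hn.
by rewrite NegzE opprK -exprnN absV Hn invrK.
Qed.

(** Discreteness of the value group: a strict inequality gains a factor [q]. *)
Lemma abs_ltz x (s : int) : absv x < Q ^ s -> absv x <= Q ^ (s - 1).
Proof.
have [->|/abs_Qz[t ->]] := eqVneq x 0; first by rewrite abs0 ltW ?Qz_gt0.
by rewrite ltr_Qz ler_Qz => st; lia.
Qed.

Lemma abs_mulz_le x (s t : int) :
  absv (x * pi ^ s) <= Q ^ t <-> absv x <= Q ^ (t + s).
Proof.
by rewrite absM abs_pi_z -invr_expz ler_pdivrMr ?Qz_gt0 // -expfzDr ?Q_neq0.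
Qed.

Lemma C0 : 0 \in C. Proof. by case: HF => _ _ _ []. Qed.

Lemma uniqC : uniq C. Proof. by case: HF => _ _ _ [[]]. Qed.

Lemma sizeC : size C = q. Proof. by case: HF => _ _ _ [[]]. Qed.

Lemma absC c : c \in C -> absv c <= 1.
Proof. by case: HF => _ _ _ [_ _ H _ _] _; exact: H. Qed.

Lemma C_eq c c' : c \in C -> c' \in C -> absv (c - c') < 1 -> c = c'.
Proof.
case: HF => _ _ _ [_ _ _ H _] _ cC c'C lt1.
by have [//|/(H _ _ cC c'C)] := eqVneq c c'.
Qed.

(** Dividing by [pi ^ (- s)], of absolute value [Q ^ s], moves [x] into the valuation ring, where
    [C] represents the residue classes. *)
Lemma digit_ex x (s : int) : absv x <= Q ^ s ->
  exists2 c, c \in C & absv (x - c * pi ^ (- s)) <= Q ^ (s - 1).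
Proof.
case: HF => _ _ _ [_ _ _ _ H] _ xs.
have pz : pi ^ (- s) != 0 by rewrite expfz_neq0 ?pi_neq0.
have [|c cC lt1] := H (x / pi ^ (- s)).
  have := iffLR (abs_mulz_le (x / pi ^ (- s)) (- s) s).
  by rewrite divfK // subrr expr0z; apply.
exists c => //.
rewrite -[X in absv (X - _)](divfK pz) -mulrBl.
apply/abs_mulz_le; rewrite addrAC subrr add0r.
by have := @abs_ltz (x / pi ^ (- s) - c) 0; rewrite expr0z add0r; apply.
Qed.

Lemma digit_dist c c' (s : int) : c \in C -> c' \in C ->
  absv (c * pi ^ (- s) - c' * pi ^ (- s)) <= Q ^ (s - 1) -> c = c'.
Proof.
move=> cC c'C; rewrite -mulrBl => /abs_mulz_le H; apply: C_eq => //.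
apply: le_lt_trans H _.
by rewrite -[ltRHS](expr0z Q) ltr_Qz; lia.
Qed.

(** * Fractional parts as digit sums at negative powers of [pi], and integral parts *)

Definition fracpart (y : F) := exists (m : nat) (c : nat -> F),
  (forall i, c i \in C) /\ y = \sum_(i < m) c i * pi ^ (- (i.+1)%:Z).

Lemma fracpart_pad m (c : nat -> F) M : (m <= M)%N -> (forall i, c i \in C) ->
  exists2 c' : nat -> F, (forall i, c' i \in C) &
    \sum_(i < m) c i * pi ^ (- (i.+1)%:Z) =
    \sum_(i < M) c' i * pi ^ (- (i.+1)%:Z).
Proof.
move=> mM cC; exists (fun i => if (i < m)%N then c i else 0).
  by move=> i; case: ifP => // _; exact: C0.
rewrite (big_ord_widen M (fun i => c i * pi ^ (- (i.+1)%:Z))) //.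
rewrite big_mkcond; apply: eq_bigr => i _.
by case: ifP => //; rewrite mul0r.
Qed.

(** Peel off the leading digit: the shorter sums have absolute value at most [Q ^ m], so the leading
    terms differ by at most [Q ^ m], and [digit_dist] makes the leading digits equal. Cancelling
    them leaves sums of length [m]. *)
Lemma fracpart_digits_uniq m (c c' : nat -> F) :
  (forall i, c i \in C) -> (forall i, c' i \in C) ->
  absv (\sum_(i < m) c i * pi ^ (- (i.+1)%:Z) -
        \sum_(i < m) c' i * pi ^ (- (i.+1)%:Z)) <= 1 ->
  \sum_(i < m) c i * pi ^ (- (i.+1)%:Z) =
  \sum_(i < m) c' i * pi ^ (- (i.+1)%:Z).
Proof.
move=> cC c'C; elim: m => [|m IH]; first by rewrite !big_ord0.
have small (d : nat -> F) : (forall i, d i \in C) ->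
    absv (\sum_(i < m) d i * pi ^ (- (i.+1)%:Z)) <= Q ^ m.
  move=> dC; apply: abs_sum_le => [|i _]; first exact/ltW/Qz_gt0.
  apply/abs_mulz_le; apply: le_trans (absC (dC i)) _.
  by rewrite -[leLHS](expr0z Q) ler_Qz; have := ltn_ord i; lia.
rewrite !big_ord_recr /=.
set S := \sum_(i < m) _; set S' := \sum_(i < m) _ => H.
suff e : c m = c' m.
  suff -> : S = S' by rewrite e.
  by apply: IH; move: H; rewrite e opprD addrACA subrr addr0.
apply: (@digit_dist _ _ m.+1) => //.
have -> : (m.+1%:Z - 1) = m by lia.
set a := c m * _ in H *; set b := c' m * _ in H *.
have -> : a - b = (S + a - (S' + b)) - (S - S') by ring.
apply: absB_le; last by apply: absB_le; exact: small.
by apply: le_trans H _; rewrite -[leLHS](expr0z Q) ler_Qz.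
Qed.

Lemma fracpart_uniq y y' : fracpart y -> fracpart y' ->
  absv (y - y') <= 1 -> y = y'.
Proof.
move=> [m [c [cC ->]]] [m' [c' [c'C ->]]].
have [d dC ->] := fracpart_pad (leq_maxl m m') cC.
have [d' d'C ->] := fracpart_pad (leq_maxr m m') c'C.
exact: fracpart_digits_uniq.
Qed.

(** Justifies the choice made in [intpart]. The digits come from iterating [z -> (z - dig z) / pi]
    on the valuation ring, starting from [x] rescaled into it. *)
Lemma intpart_ex x : exists y, is_intpart absv pi C x y.
Proof.
have [n xn] : exists n : nat, absv x <= Q ^ n.
  have [->|/abs_Qz[s ->]] := eqVneq x 0.
    by exists 0%N; rewrite abs0 ltW ?Qz_gt0.
  by exists `|s|%N; rewrite ler_Qz; lia.
have [dig Hdig] : exists dig : F -> F, forall z, dig z \in C /\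
    (absv z <= 1 -> absv (z - dig z) < 1).
  suff : forall z, exists d, d \in C /\
      (absv z <= 1 -> absv (z - d) < 1) by move=> /choice[d Hd]; exists d.
  move=> z; have [z1|z1] := boolP (absv z <= 1); last by exists 0; rewrite C0.
  by case: HF => _ _ _ [_ _ _ _ /(_ z z1)[d ? ?]] _; exists d.
pose v : int := - n%:Z.
pose r i := iter i (fun z => (z - dig z) / pi) (x / pi ^ v).
have pv (t : int) : pi ^ t != 0 by rewrite expfz_neq0 ?pi_neq0.
have r1 i : absv (r i) <= 1.
  elim: i => [|i IH] /=.
    rewrite absM absV abs_pi_z opprK ler_pdivrMr ?mul1r ?Qz_gt0 //.
  have := (Hdig (r i)).2 IH; rewrite -[ltRHS](expr0z Q) => /abs_ltz.
  rewrite absM absV abs_pi invrK -ler_pdivlMr ?Q_gt0 // mul1r.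
  by move/le_trans; apply; rewrite sub0r exprN1.
(* The error after [M] digits is [r M * pi ^ (v + M)]; it tends to 0 because [r M] stays in the
   valuation ring. *)
have xE M : x - \sum_(i < M) dig (r i) * pi ^ (v + i%:Z) =
    r M * pi ^ (v + M%:Z).
  elim: M => [|M IH]; first by rewrite big_ord0 subr0 addr0 /r /= divfK.
  rewrite big_ord_recr /= opprD addrA IH -mulrBl.
  have -> : v + M.+1%:Z = 1 + (v + M%:Z) by lia.
  by rewrite [in RHS]expfzDr ?pi_neq0 // expr1z mulrA divfK ?pi_neq0.
exists (x - \sum_(i < `|v|%N | v + i%:Z < 0) dig (r i) * pi ^ (v + i%:Z)).
exists v, (fun i => dig (r i)); split => //; split=> [i|].
  by have [] := Hdig (r i).
apply: (@squeeze_cvgr _ _ _ _ (fun=> 0) (fun M => Q ^ n * Q^-1 ^+ M)).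
- apply: nearW => M; rewrite abs_ge0 absBC xE absM abs_pi_z /=.
  apply: le_trans (ler_piMl _ (r1 M)) _; first exact/ltW/Qz_gt0.
  by rewrite opprD opprK expfzDr ?Q_neq0 // exprVn -exprnN.
- exact: cvg_cst.
- rewrite -[X in _ --> X](mulr0 (Q ^ n)); apply: cvgMl_tmp.
  apply: cvg_expr; rewrite ger0_norm ?invr_ge0 ?ler0n //.
  by rewrite invf_lt1 ?Q_gt0 ?Q_gt1.
Qed.

(** These two properties determine [y], by [fracpart_uniq], and make later arguments independent of
    the expansion chosen. *)
Lemma is_intpart_spec x y : is_intpart absv pi C x y ->
  absv y <= 1 /\ fracpart (x - y).
Proof.
move=> [v [c [[cC cv] ->]]]; split; last first.
  rewrite subKr; case: v {cv} => n.
    exists 0%N, (fun=> 0); split; first by move=> _; exact: C0.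
    by rewrite big_ord0 big_pred0 // => i; lia.
  (* Here [v = - (n + 1)]; reversing the digits lists the exponents as [-1, ..., - (n + 1)]. *)
  exists n.+1, (fun i => c (n - i)%N); split => //.
  rewrite NegzE abszN absz_nat (reindex_inj rev_ord_inj) /=.
  apply: eq_big => [i|i _]; first by have := ltn_ord i; lia.
  rewrite subSS; congr (_ * pi ^ _); have := ltn_ord i; lia.
(* A partial sum within 1 of [x] that already contains all negative exponents; its other terms lie
   in the valuation ring. *)
have [M [vM HM]] : exists M, (`|v| <= M)%N /\
    absv (\sum_(i < M) c i * pi ^ (v + i%:Z) - x) <= 1.
  have /cvgrPdist_le/(_ 1 ltr01)[N _ HN] := cv.
  exists (maxn `|v| N); split; first exact: leq_maxl.
  have := HN (maxn `|v| N) (leq_maxr _ _).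
  by rewrite sub0r normrN ger0_norm ?abs_ge0.
rewrite (big_ord_widen_cond M (fun i => v + i%:Z < 0)
  (fun i => c i * pi ^ (v + i%:Z))) //.
have -> : \sum_(i < M | (v + i%:Z < 0) && (i < `|v|)%N) c i * pi ^ (v + i%:Z) =
    \sum_(i < M | v + i%:Z < 0) c i * pi ^ (v + i%:Z).
  by apply: eq_bigl => i; lia.
set P := \sum_(i < M | _) _.
have /esym E : \sum_(i < M) c i * pi ^ (v + i%:Z) =
    P + \sum_(i < M | ~~ (v + i%:Z < 0)) c i * pi ^ (v + i%:Z).
  by rewrite (bigID (fun i : 'I_M => v + i%:Z < 0)).
set S := \sum_(i < M) _ in E HM; set T := \sum_(i < M | _) _ in E.
have -> : x - P = T - (S - x) by rewrite -E; ring.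
apply: absB_le HM; apply: abs_sum_le => // i vi.
rewrite -(expr0z Q); apply/abs_mulz_le; apply: le_trans (absC (cC i)) _.
by rewrite -[leLHS](expr0z Q) ler_Qz; lia.
Qed.

Local Notation ip := (intpart absv pi C).

Lemma intpart_spec x : absv (ip x) <= 1 /\ fracpart (x - ip x).
Proof. 
apply: is_intpart_spec; apply: ClassicalEpsilon.epsilon_spec.
exact: intpart_ex.
 Qed.

(** The two fractional parts differ by an element of the valuation ring, hence coincide. So at
    distances up to 1, [f] and its integral part have the same geometry. *)
Lemma intpartB x x' : absv (x - x') <= 1 -> ip x - ip x' = x - x'.
Proof.
move=> xx'; have [a fa] := intpart_spec x; have [b fb] := intpart_spec x'.
have /(fracpart_uniq fa fb) H : absv (x - ip x - (x' - ip x')) <= 1.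
  have -> : x - ip x - (x' - ip x') = (x - x') - (ip x - ip x').
    by ring.
  by apply: absB_le => //; apply: absB_le.
by rewrite -(subKr x (ip x)) H; ring.
Qed.

(** * Disks and their subdivision *)

Local Notation T := (g_sigma_algebraType (disks absv q)).
Local Notation D a s := (disk absv a (Q ^ s)).
Local Notation child a s c := (a + c * pi ^ (- s)).

Lemma disk_refl a s : D a s a.
Proof. by rewrite /disk /= subrr abs0 ltW ?Qz_gt0. Qed.

Lemma disk_sub a b s t : s <= t -> D a t b -> D b s `<=` D a t.
Proof.
rewrite /disk => st ab x /= bx; have -> : x - a = (x - b) + (b - a) by ring.
by apply: absD_le => //; apply: le_trans bx _; rewrite ler_Qz.
Qed.

Lemma child_in a s c : c \in C -> D a s (child a s c).
Proof.
move=> cC; rewrite /disk /= addrAC subrr add0r; apply/abs_mulz_le.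
by rewrite subrr expr0z; exact: absC.
Qed.

Lemma disk_split a s :
  D a s = \bigcup_(c in [set` C]) D (child a s c) (s - 1).
Proof.
apply/seteqP; split=> [x ax|x [c /= cC]]; last first.
  by apply: disk_sub; [rewrite gerBl | exact: child_in].
by have [c cC cx] := digit_ex ax; exists c; rewrite // /disk /= opprD addrA.
Qed.

Lemma trivIset_children a s :
  trivIset [set` C] (fun c => D (child a s c) (s - 1)).
Proof.
move=> c c' cC c'C [x [cx c'x]]; apply: (@digit_dist c c' s cC c'C).
have -> : c * pi ^ (- s) - c' * pi ^ (- s) =
   (x - child a s c') - (x - child a s c) by ring.
exact: absB_le.
Qed.

(** Induction on [t - s] through children, serving to glue facts at a fine scale, first
    measurability and then ratios of measures, over a larger disk. *)
Lemma disk_rec (P : F -> int -> Prop) (s : int) :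
  (forall x t, s < t -> (forall c, c \in C -> P (child x t c) (t - 1)) ->
    P x t) ->
  forall a t, s <= t -> (forall x, D a t x -> P x s) -> P a t.
Proof.
move=> Prec a t st; have -> : t = s + `|t - s|%N by lia.
elim: (`|t - s|%N) a => [|m IH] a Ps.
  by rewrite addr0; apply: Ps; rewrite addr0; exact: disk_refl.
apply: Prec => [|c cC]; first lia.
have e : s + m.+1%:Z - 1 = s + m%:Z by lia.
rewrite e; apply: IH => x cx; apply: Ps.
by rewrite disk_split; exists c; rewrite ?e.
Qed.

Lemma measurable_disk a s : measurable (D a s : set T).
Proof. by apply: sub_sigma_algebra; exists a, s. Qed.

Lemma disk_glue_measurable (Y : set T) a s t : s <= t ->
  (forall x, D a t x -> measurable (D x s `&` Y : set T)) ->
  measurable (D a t `&` Y : set T).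
Proof.
move: a t.
apply: (@disk_rec (fun x t => measurable (D x t `&` Y : set T))) => x t _ Pc.
rewrite disk_split setI_bigcupl; exact: fin_bigcup_measurable.
Qed.

(** * Haar measure of disks *)

Section Haar.
Variable mu : {measure set T -> \bar R}.
Hypothesis mu_transl : forall (a : F) (A : set T),
  measurable A -> mu [set x | A (x + a)] = mu A.
Hypothesis mu_O : mu (disk absv 0 1) = 1%E.

Lemma measure_disk_split (Y : set T) a s : measurable Y ->
  mu (D a s `&` Y) = (\sum_(c <- C) mu (D (child a s c) (s - 1) `&` Y))%E.
Proof.
move=> mY; rewrite disk_split setI_bigcupl measure_fin_bigcup.
- by rewrite -fsbig_seq //; exact: uniqC.
- exact: finite_seq.
- move=> c c' cC c'C [x [[cx _] [c'x _]]].
  by apply: (@trivIset_children a s c c' cC c'C); exists x.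
- by move=> c _; apply: measurableI => //; exact: measurable_disk.
Qed.

Lemma measure_disk_transl a b s : mu (D a s) = mu (D b s).
Proof.
rewrite -(@mu_transl (a - b)); last exact: measurable_disk.
congr (mu _); apply/seteqP; split=> x; rewrite /disk /= => H.
  by have -> : x - b = x + (a - b) - a by ring.
by have -> : x + (a - b) - a = x - b by ring.
Qed.

(** By translation invariance the [q] children have equal measure. *)
Lemma measure_diskS a s : mu (D a s) = (Q%:E * mu (D a (s - 1)))%E.
Proof.
rewrite -[in LHS](setIT (D a s)) measure_disk_split //.
under eq_bigr do rewrite setIT (measure_disk_transl _ a).
by rewrite big_const_seq count_predT sizeC iter_addr_0 mule_natl.
Qed.

Lemma measure_disk_pred a s : mu (D a (s - 1)) = (Q^-1%:E * mu (D a s))%E.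
Proof.
by rewrite [in RHS]measure_diskS muleA -EFinM mulVf ?Q_neq0 // mul1e.
Qed.

Lemma measure_disk a s : mu (D a s) = (Q ^ s)%:E.
Proof.
rewrite (measure_disk_transl a 0); elim/int_rect: s => [|n IH|n IH].
- by rewrite expr0z.
- rewrite measure_diskS; have -> : n.+1%:Z - 1 = n%:Z by lia.
  by rewrite IH -EFinM -!exprnP exprS.
- have -> : - n.+1%:Z = - n%:Z - 1 by lia.
  by rewrite measure_disk_pred IH -EFinM addrC expfzDr ?Q_neq0.
Qed.

(** Both sides are additive over children, so a common ratio [r] at the fine scale survives at every
    coarser one. *)
Lemma disk_glue_measure (Y Z : set T) (r : R) a s t :
  measurable Y -> measurable Z -> s <= t ->
  (forall x, D a t x -> mu (D x s `&` Y) = (r%:E * mu (D x s `&` Z))%E) ->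
  mu (D a t `&` Y) = (r%:E * mu (D a t `&` Z))%E.
Proof.
move=> mY mZ; move: a t.
apply: (@disk_rec (fun x t => mu (D x t `&` Y) = (r%:E * mu (D x t `&` Z))%E)).
move=> x t _ Pc; rewrite !measure_disk_split // ge0_sume_distrr //.
by rewrite big_seq [RHS]big_seq; apply: eq_bigr.
Qed.

(** * Level sets of the integral parts *)

Section Level.
Variables (a0 : F) (k0 : int) (a : F).
Hypothesis a1 : absv a <= 1.

Definition level (f : F -> F) (j : nat) : set T :=
  [set x | D a0 k0 x /\ absv (ip (f x) - a) <= Q ^ (- j%:Z)].

Lemma level0 f : level f 0 = D a0 k0.
Proof.
apply/seteqP; split=> x; first by case.
move=> xO; split => //; rewrite oppr0 expr0z.
by apply: absB_le a1; have [] := intpart_spec (f x).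
Qed.

Lemma level_le f i j : (i <= j)%N -> level f j `<=` level f i.
Proof.
move=> ij x [xO H]; split=> //; apply: le_trans H _.
by rewrite ler_Qz; lia.
Qed.

Lemma Qz_le1 (t : int) : t <= 0 -> Q ^ t <= 1.
Proof. by move=> t0; rewrite -(expr0z Q) ler_Qz. Qed.

Lemma disk_finite : (mu (D a0 k0) < +oo)%E.
Proof. by rewrite measure_disk ltry. Qed.

(** For [f = f_n] this is [X_n] at level [j]. As levels are nested, its values are [1 - 1/q], [-1/q]
    and 0. *)
Definition osc (f : F -> F) (j : nat) (x : T) : R :=
  \1_(level f j.+1) x - Q^-1 * \1_(level f j) x.

Lemma osc_le1 f j x : `|osc f j x| <= 1.
Proof.
have Q1 : Q^-1 <= 1 by rewrite invf_le1 ?Q_gt0 ?ltW ?Q_gt1.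
have Q0 : 0 <= Q^-1 by rewrite invr_ge0 ltW ?Q_gt0.
rewrite /osc !indicE ler_norml.
have [/set_mem H|_] := boolP (x \in level f j.+1).
  by rewrite mem_set /=; [lra | exact: level_le H].
by case: (x \in _) => /=; lra.
Qed.

Section Scaling.
Variables (f : F -> F) (lam : int).
Hypothesis f_scaling : scaling_on absv (D a0 k0) q lam f.
Hypothesis lamk0 : - k0 <= lam.

Lemma scaling_le x y t : D a0 k0 x -> D a0 k0 y ->
  absv (f x - f y) <= Q ^ t <-> absv (x - y) <= Q ^ (t - lam).
Proof.
move=> xO yO; rewrite f_scaling // mulrC -ler_pdivlMr ?Qz_gt0 //.
by rewrite invr_expz -expfzDr ?Q_neq0.
Qed.

Lemma intpart_scaling x y t : t <= 0 -> D a0 k0 x -> D a0 k0 y ->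
  absv (x - y) <= Q ^ (t - lam) -> absv (ip (f x) - ip (f y)) <= Q ^ t.
Proof.
move=> t0 xO yO /(scaling_le _ xO yO) H; rewrite intpartB //.
exact: le_trans (Qz_le1 t0).
Qed.

Lemma level_near j x y : D a0 k0 y -> absv (y - x) <= Q ^ (- j%:Z - lam) ->
  level f j x -> level f j y.
Proof.
move=> yO yx [xO xj]; split=> //.
have -> : ip (f y) - a = (ip (f y) - ip (f x)) + (ip (f x) - a) by ring.
by apply: absD_le => //; apply: intpart_scaling => //; lia.
Qed.

(** Over a disk of radius [Q ^ (- j - lam)] the values of [f], and with them their integral parts,
    vary by at most [Q ^ (- j)], so membership in level [j] cannot change. *)
Lemma disk_level j s x : s <= - j%:Z - lam -> D a0 k0 x ->
  D x s `&` level f j = D x s \/ D x s `&` level f j = set0.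
Proof.
(* Condition (a), as [lamk0], places the disk inside the domain. *)
move=> sj xO; have sk : s <= k0 by lia.
have xs y : D x s y -> D a0 k0 y /\ absv (y - x) <= Q ^ (- j%:Z - lam).
  move=> xy; split; first exact: disk_sub xy.
  by apply: le_trans xy _; rewrite ler_Qz.
have [xj|xj] := pselect (level f j x); [left|right].
  by apply/setIidPl => y /xs[yO yx]; exact: level_near xj.
apply/seteqP; split=> // y [/xs[yO yx]]; rewrite absBC in yx.
by move/(level_near xO yx).
Qed.

Lemma measurable_level j : measurable (level f j).
Proof.
have -> : level f j = D a0 k0 `&` level f j.
  by apply/esym/setIidPr => x [].
apply: (@disk_glue_measurable _ _ (- j%:Z - lam)); first lia.
move=> x xO; have [->|->] := @disk_level j _ x (lexx _) xO.
  exact: measurable_disk.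
exact: measurable0.
Qed.

(** Pigeonhole: reading on each child the digit of [ip f - a] at [pi ^ j] gives an injective map
    from [C] to itself, hence onto; the child with digit 0 reaches level [j + 1]. *)
Lemma level_child j x : level f j x ->
  exists2 y, absv (y - x) <= Q ^ (- j%:Z - lam) & level f j.+1 y.
Proof.
move=> [xO xj]; set s : int := - j%:Z - lam.
have chO c : c \in C -> D a0 k0 (child x s c).
  by move=> cC; apply: (@disk_sub a0 x s k0); [lia | | exact: child_in].
have near c : c \in C -> absv (ip (f (child x s c)) - a) <= Q ^ (- j%:Z).
  move=> cC.
  by have [] := level_near (chO c cC) (@child_in x s c cC) (conj xO xj).
have /choice[g Hg] : forall c, exists d, c \in C -> d \in C /\
    absv (ip (f (child x s c)) - a - d * pi ^ j) <= Q ^ (- j%:Z - 1).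
  move=> c; have [cC|cC] := boolP (c \in C); last by exists 0.
  by have [d dC] := digit_ex (near c cC); rewrite opprK => dc; exists d.
(* Equal digits put the integral parts within [Q ^ (- j - 1)] of each other; by [intpartB] so are
   the values of [f], and scaling back shows that the children coincide. *)
have g_inj : {in C &, injective g}.
  move=> c c' cC c'C gg; have [_ cd] := Hg c cC; have [_ c'd] := Hg c' c'C.
  apply: (@digit_dist c c' s cC c'C).
  have -> : c * pi ^ (- s) - c' * pi ^ (- s) = child x s c - child x s c'.
    by ring.
  have -> : s - 1 = (- j%:Z - 1) - lam by rewrite /s; ring.
  apply/(scaling_le _ (chO c cC) (chO c' c'C)).
  have d1 : absv (child x s c - child x s c') <= Q ^ s.
    have -> : child x s c - child x s c' =
       (child x s c - x) - (child x s c' - x) by ring.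
    by apply: absB_le; exact: child_in.
  have d2 : absv (f (child x s c) - f (child x s c')) <= 1.
    apply: le_trans (Qz_le1 (_ : - j%:Z <= 0)); last lia.
    by apply/(scaling_le _ (chO c cC) (chO c' c'C)); rewrite -/s.
  rewrite -intpartB //; rewrite -gg in c'd.
  set u := ip _ in cd *; set v := ip _ in c'd *; set d := g c * _ in cd c'd.
  have -> : u - v = (u - a - d) - (v - a - d) by ring.
  exact: absB_le.
have [|d /mapP[c cC ->]||_ gC] := @uniq_min_size _ (map g C) C.
- by rewrite map_inj_in_uniq // uniqC.
- by have [] := Hg c cC.
- by rewrite size_map.
have /mapP[c cC c0] : 0 \in map g C by rewrite gC C0.
exists (child x s c); first exact: child_in.
split; first exact: chO.
have [_] := Hg c cC; rewrite -c0 mul0r subr0 => /le_trans; apply.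
by rewrite ler_Qz; lia.
Qed.

(** Level [j] is all or nothing on this disk. If it is all, the part in level [j + 1] is exactly the
    child around the point [y] of [level_child], again by scaling, and has a [q]-th of the
    measure. *)
Lemma measure_levelS j x : D a0 k0 x ->
  mu (D x (- j%:Z - lam) `&` level f j.+1) =
  (Q^-1%:E * mu (D x (- j%:Z - lam) `&` level f j))%E.
Proof.
set s : int := - j%:Z - lam; move=> xO; have sk : s <= k0 by lia.
have [e|e] := @disk_level j _ x (lexx _) xO; last first.
  rewrite e measure0 mule0 (_ : D x s `&` _ = set0) ?measure0 //.
  apply/seteqP; split=> // y [xy yj]; rewrite -e.
  by split=> //; exact: level_le yj.
have /level_child[y yx yj] : level f j x.
  by have [] : (D x s `&` level f j) x by rewrite e; exact: disk_refl.
have [yO yja] := yj.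
rewrite e -measure_disk_pred (measure_disk_transl x y); congr (mu _).
have js : - j.+1%:Z - lam = s - 1 by rewrite /s; lia.
apply/seteqP; split=> z; last first.
  move=> yz; have xz : D x s z.
    by apply: disk_sub yz; [rewrite gerBl | exact: yx].
  split=> //; apply: level_near yj; last by rewrite js.
  exact: disk_sub xz.
move=> [xz [zO zj]]; rewrite /disk /= -js; apply/(scaling_le _ zO yO).
rewrite -intpartB; last first.
  apply: le_trans (Qz_le1 (_ : - j%:Z <= 0)); last lia.
  apply/(scaling_le _ zO yO).
  by have -> : z - y = (z - x) - (y - x) by [ring]; exact: absB_le.
have -> : ip (f z) - ip (f y) = (ip (f z) - a) - (ip (f y) - a) by ring.
exact: absB_le.
Qed.

(** Inside the domain [E] consists of disks where [measure_levelS] applies, so the ratio glues;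
    equivalently, [osc f j] integrates to 0 over that part of [E]. *)
Lemma measure_levelS_setI (E : set T) j : measurable E ->
  (forall x, D a0 k0 x ->
     let s : int := - j%:Z - lam in D x s `&` E = D x s \/ D x s `&` E = set0) ->
  mu (D a0 k0 `&` (E `&` level f j.+1)) =
  (Q^-1%:E * mu (D a0 k0 `&` (E `&` level f j)))%E.
Proof.
move=> mE Es; apply: (@disk_glue_measure _ _ _ _ (- j%:Z - lam)).
- by apply: measurableI => //; exact: measurable_level.
- by apply: measurableI => //; exact: measurable_level.
- by lia.
move=> x xO; rewrite !(setIA _ E); have /= [->|->] := Es x xO.
  exact: measure_levelS.
by rewrite !set0I measure0 mule0.
Qed.

Lemma measurable_osc j : measurable_fun setT (osc f j).
Proof.
by apply: measurable_funB; [|apply: measurable_funM => //];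
  apply: measurable_indic; exact: measurable_level.
Qed.

Lemma integrable_osc_bounded (h : T -> R) j : measurable_fun setT h ->
  (forall x, `|h x| <= 1) ->
  mu.-integrable (D a0 k0) (EFin \o (fun x => h x * osc f j x)).
Proof.
move=> mh h1; apply: (@bounded_integrable _ _ _ _ _ _ 1).
- exact: measurable_disk.
- exact: disk_finite.
- apply: measurable_funTS; apply: measurable_funM => //.
  exact: measurable_osc.
- by move=> x; rewrite normrM mulr_ile1 // osc_le1.
Qed.
End Scaling.

(** * Orthogonality for different scaling ratios *)

Section Orthogonality.
Variables (f g : F -> F) (lam lam' : int).
Hypothesis f_scaling : scaling_on absv (D a0 k0) q lam f.
Hypothesis g_scaling : scaling_on absv (D a0 k0) q lam' g.
Hypothesis lamk0 : - k0 <= lam.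
Hypothesis lt_lam : lam < lam'.

(** [level f i] is a union of disks of radius [Q ^ (- i - lam)], which is at least the radius
    [Q ^ (- j - lam')] of the disks on which [osc g j] has mean zero. *)
Lemma integral_indic_osc i j : (i <= j.+1)%N ->
  (\int[mu]_(x in D a0 k0) (\1_(level f i) x * osc g j x)%:E)%E = 0%E.
Proof.
move=> ij; have lamk0' : - k0 <= lam' by lia.
have mD : measurable (D a0 k0 : set T) by exact: measurable_disk.
set E := level f i; have mE : measurable E.
  exact: measurable_level f_scaling _ _.
have mL k : measurable (E `&` level g k).
  by apply: measurableI => //; exact: measurable_level g_scaling _ _.
have I k : mu.-integrable (D a0 k0)
    (EFin \o (fun x => \1_(E `&` level g k) x : R)).
  apply: (@bounded_integrable _ _ _ _ _ _ 1) => //.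
  - exact: disk_finite.
  - by apply: measurable_funTS; apply: measurable_indic.
  - by move=> x; rewrite indicE ger0_norm // lern1 leq_b1.
transitivity (\int[mu]_(x in D a0 k0) ((\1_(E `&` level g j.+1) x)%:E -
    Q^-1%:E * (\1_(E `&` level g j) x)%:E))%E.
  apply: eq_integral => x _; rewrite /osc -EFinM -EFinB; congr (_%:E).
  have ind k : \1_(E `&` level g k) x = \1_E x * \1_(level g k) x :> R.
    by rewrite indicI.
  by rewrite !ind mulrBr mulrCA.
rewrite integralB //; [|exact: I|by apply: integrableZl => //; exact: I].
rewrite integralZl //; last exact: I.
rewrite !integral_indic // setIC [X in (_ - _ * mu X)%E]setIC.
rewrite (measure_levelS_setI g_scaling lamk0' mE) ?subee //.
  rewrite fin_numM // ge0_fin_numE //.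
  by apply: le_lt_trans disk_finite; apply: le_measure; rewrite ?inE //;
    exact: measurableI.
(* As integers, [lam < lam'] leaves a gap of at least 1, which absorbs the case [i = j + 1]. *)
move=> x xO; apply: (disk_level f_scaling lamk0) => //; lia.
Qed.

(** Only [osc f j] is expanded; its indicators have levels [j + 1] and [j], both covered by
    [integral_indic_osc]. *)
Lemma integral_osc_osc j :
  (\int[mu]_(x in D a0 k0) (osc f j x * osc g j x)%:E)%E = 0%E.
Proof.
have lamk0' : - k0 <= lam' by lia.
have mD : measurable (D a0 k0 : set T) by exact: measurable_disk.
have I k : mu.-integrable (D a0 k0)
    (EFin \o (fun x => \1_(level f k) x * osc g j x)).
  apply: (integrable_osc_bounded g_scaling lamk0').
  - by apply: measurable_indic; exact: (measurable_level f_scaling).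
  - by move=> x; rewrite indicE ger0_norm // lern1 leq_b1.
transitivity (\int[mu]_(x in D a0 k0) ((\1_(level f j.+1) x * osc g j x)%:E -
    Q^-1%:E * (\1_(level f j) x * osc g j x)%:E))%E.
  apply: eq_integral => x _; rewrite -EFinM -EFinB; congr (_%:E).
  by rewrite {1}/osc mulrBl mulrA.
rewrite integralB //; [|exact: I|by apply: integrableZl => //; exact: I].
rewrite integralZl //; last exact: I.
by rewrite !integral_indic_osc // mule0 sube0.
Qed.
End Orthogonality.

(** * Variance bound and limiting frequencies *)

Lemma card_KE (l : nat -> int) N : ((card_K l N)%:R : R) =
  \sum_(1 <= i < N.+1) \sum_(1 <= k < N.+1) (l i == l k)%:R.
Proof.
rewrite /card_K -sum1_card natr_sum big_geq_mkord.
under [RHS]eq_bigr do rewrite big_geq_mkord.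
rewrite pair_big /= [LHS]big_mkcond [RHS]big_mkcond.
apply: eq_bigr => -[i k] _; rewrite unfold_in /= /in_set asboolb.
by case: (0 < i)%N; case: (0 < k)%N; case: eqP.
Qed.

Section Sequence.
Variables (f : nat -> F -> F) (lam : nat -> int).
Hypothesis f_scaling : forall n, scaling_on absv (D a0 k0) q (lam n) (f n).
Hypothesis lamk0 : forall n, - k0 <= lam n.

Lemma osc_sum_variance N j :
  (\int[mu]_(x in D a0 k0) ((\sum_(1 <= n < N.+1) osc (f n) j x) ^+ 2)%:E <=
   (Q ^ k0 * (card_K lam N)%:R)%:E)%E.
Proof.
have mD : measurable (D a0 k0 : set T) by exact: measurable_disk.
have mX n := measurable_osc (f_scaling n) (lamk0 n) j.
have I i k : mu.-integrable (D a0 k0)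
    (EFin \o (fun x => osc (f i) j x * osc (f k) j x)).
  by apply: (integrable_osc_bounded (f_scaling k) (lamk0 k)) => // x;
    exact: osc_le1.
under eq_integral => x _ do rewrite expr2 big_distrlr /= -sumEFin.
rewrite integral_sum //; last first.
  move=> i; under eq_fun do rewrite -sumEFin.
  by apply: integrable_sum => // k _; exact: I.
rewrite card_KE mulr_sumr -sumEFin; apply: lee_sum => i _.
under eq_integral => x _ do rewrite -sumEFin.
rewrite integral_sum //; last by move=> k; exact: I.
rewrite mulr_sumr -sumEFin; apply: lee_sum => k _.
(* Pairs with equal exponents contribute at most the measure [Q ^ k0] of the disk, all others
   nothing. *)
have [ik|/lt_total/orP[ik|ik]] := eqVneq (lam i) (lam k).
- rewrite mulr1 -(measure_disk a0) -[leRHS]mul1e -integral_cst //.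
  apply: le_integral => //; first exact: I.
    apply: (@bounded_integrable _ _ _ _ _ (fun=> 1) 1) => //.
    - exact: disk_finite.
    - by move=> x; rewrite normr1.
  move=> x _; rewrite lee_fin (le_trans (ler_norm _)) // normrM.
  by rewrite mulr_ile1 // osc_le1.
- by rewrite (integral_osc_osc (f_scaling i) (f_scaling k)) // mulr0.
(* The orthogonality lemma wants the smaller exponent first, so the factors are swapped. *)
- under eq_integral => x _ do rewrite mulrC.
  by rewrite (integral_osc_osc (f_scaling k) (f_scaling i)) // mulr0.
Qed.

Hypothesis card_K_series :
  (\sum_(0 <= N <oo) ((card_K lam N)%:R / (N%:R : R) ^+ 3)%:E < +oo)%E.

Lemma ae_osc_avg j : {ae mu, forall x : T, D a0 k0 x ->
  (fun N => (\sum_(1 <= n < N.+1) osc (f n) j x) / N%:R) @ \oo --> (0 : R)}.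
Proof.
apply: (@ae_avg_cvg0 _ _ _ _ _ _ (card_K lam) (Q ^ k0)) => //.
- exact: measurable_disk.
- exact/ltW/Qz_gt0.
- move=> n; apply: measurable_funTS.
  exact: (measurable_osc (f_scaling n) (lamk0 n)).
- by move=> n x; exact: osc_le1.
- by move=> N; exact: osc_sum_variance.
Qed.

Lemma ae_level_freq : {ae mu, forall x : T, D a0 k0 x -> forall j : nat,
  (fun N => (\sum_(1 <= n < N.+1) \1_(level (f n) j) x) / N%:R) @ \oo -->
    (Q ^ (- j%:Z) : R)}.
Proof.
(* Countably many null sets are joined, so one serves all [j] and the induction on [j] runs at a
   fixed [x]. *)
apply: filterS (ae_foralln ae_osc_avg) => x oscx xO.
elim=> [|j IH].
  (* Level 0 is the whole disk, so the average is [N / N], equal to 1 once [N > 0]. *)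
  rewrite oppr0 expr0z; apply: cvg_near_cst; near=> N.
  under eq_bigr do rewrite level0 indicE mem_set //.
  rewrite sumr_const_nat subSS subn0 divff // pnatr_eq0 -lt0n.
  by near: N; exact: nbhs_infty_gt.
have -> : Q ^ (- j.+1%:Z) = 0 + Q^-1 * Q ^ (- j%:Z).
  have -> : - j.+1%:Z = -1 - j%:Z by lia.
  by rewrite add0r expfzDr ?Q_neq0 // exprN1.
rewrite (_ : (fun N => _) = (fun N =>
  (\sum_(1 <= n < N.+1) osc (f n) j x) / N%:R +
  Q^-1 * ((\sum_(1 <= n < N.+1) \1_(level (f n) j) x) / N%:R))).
  by apply: cvgD; [exact: oscx | exact: cvgMl_tmp].
apply/funext => N; rewrite mulrA -mulrDl; congr (_ / _).
rewrite mulr_sumr -big_split /=; apply: eq_bigr => n _.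
by rewrite /osc subrK.
Unshelve. all: by end_near.
Qed.

End Sequence.
End Level.
End Haar.

(** * A countable dense set of centres *)

Fixpoint digits_val (l : seq nat) : F :=
  if l is i :: l' then nth 0 C i + pi * digits_val l' else 0.

(** An index past the end of [C] reads the default 0, so every list gives a point of the valuation
    ring. *)
Lemma digits_val_le1 l : absv (digits_val l) <= 1.
Proof.
elim: l => [|i l IH] /=; first by rewrite abs0.
apply: absD_le.
  have [iC|iC] := ltnP i (size C); first by apply: absC; exact: mem_nth.
  by rewrite nth_default // abs0.
rewrite absM mulr_ile1 ?abs_ge0 // abs_pi invf_le1 ?Q_gt0 //.
exact/ltW/Q_gt1.
Qed.

(** Horner expansion of [b] to [k] digits. As lists of naturals are countable, it reduces all
    centres to countably many. *)
Lemma digits_val_dense b (k : nat) : absv b <= 1 ->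
  exists l, absv (b - digits_val l) <= Q ^ (- k%:Z).
Proof.
elim: k b => [|k IH] b b1; first by exists [::]; rewrite subr0 oppr0 expr0z.
have [c cC bc] : exists2 c, c \in C & absv (b - c) < 1.
  by case: HF => _ _ _ [_ _ _ _ H] _; exact: H.
have [|l bl] := IH ((b - c) / pi).
  move: bc; rewrite -(expr0z Q) => /abs_ltz; rewrite add0r exprN1 => bc.
  by rewrite absM absV abs_pi invrK -ler_pdivlMr ?Q_gt0 // mul1r.
exists (index c C :: l); rewrite /= nth_index //.
have -> : b - (c + pi * digits_val l) = ((b - c) / pi - digits_val l) * pi ^ 1.
  by rewrite expr1z mulrBl divfK ?pi_neq0 //; ring.
apply/abs_mulz_le; apply: le_trans bl _; rewrite ler_Qz; lia.
Qed.

End Valuation.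

(** * Uniform distribution for all disks at once *)

Lemma card_near_sum (R : realType) (F : fieldType) (absv : F -> R)
    (s : nat -> F) (b : F) (r : R) N :
  (#|[set n : 'I_N.+1 | (0 < val n)%N && (absv (s (val n) - b) <= r)]|%:R : R) =
  \sum_(1 <= n < N.+1) ((absv (s n - b) <= r)%R)%:R.
Proof.
rewrite -sum1_card natr_sum big_geq_mkord [LHS]big_mkcond [RHS]big_mkcond /=.
apply: eq_bigr => i _; rewrite unfold_in /= /in_set asboolb.
by case: (0 < i)%N; case: (_ <= _).
Qed.

Theorem theorem1p2 (R : realType) (F : fieldType) (absv : F -> R) (pi : F)
  (q : nat) (C : seq F)
  (HF : nonarch_local_field absv pi q C)
  (mu : {measure set (g_sigma_algebraType (disks absv q)) -> \bar R})
  (mu_transl : forall (a : F) (A : set (g_sigma_algebraType (disks absv q))),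
     measurable A -> mu [set x | A (x + a)] = mu A)
  (mu_O : mu (disk absv 0 1) = 1%E)
  (a0 : F) (k0 : int)
  (f : nat -> F -> F) (lam : nat -> int)
  (Hscal : forall n, (0 < n)%N -> scaling_on absv (disk absv a0 ((q%:R) ^ k0)) q (lam n) (f n))
  (Ha : forall n, (0 < n)%N -> (q%:R : R) ^ (lam n) >= ((q%:R : R) ^ k0)^-1)
  (Hb : (\sum_(1 <= N <oo) ((card_K lam N)%:R / (N%:R : R) ^+ 3)%:E < +oo)%E) :
  {ae mu, forall x : g_sigma_algebraType (disks absv q),
     disk absv a0 ((q%:R) ^ k0) x ->
     unif_distr_O absv q (fun n => intpart absv pi C (f n x))}.
Proof.
(* Index 0 carries no hypothesis; [pos] redirects it to 1. *)
pose pos n := maxn 1 n.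
have pos0 n : (0 < pos n)%N by rewrite /pos; lia.
have posE n : (0 < n)%N -> pos n = n by rewrite /pos; lia.
have lamk0 n : - k0 <= lam (pos n).
  by have := Ha _ (pos0 n); rewrite invr_expz (ler_Qz HF).
have fin : (\sum_(0 <= N <oo)
    ((card_K (lam \o pos) N)%:R / (N%:R : R) ^+ 3)%:E < +oo)%E.
  (* The added term [N = 0] vanishes since the inverse of 0 is 0. *)
  rewrite (@nneseries_split _ _ 0 1); last first.
    by move=> k _; rewrite lee_fin divr_ge0 ?exprn_ge0.
  rewrite add0n big_nat1 expr0n invr0 mulr0 add0e.
  under eq_eseriesr => N _.
    (* [card_K] counts positive indices only, where [pos] is the identity. *)
    rewrite (_ : card_K (lam \o pos) N = card_K lam N); last first.
      apply: eq_card => -[i k]; rewrite !unfold_in /= /in_set !asboolb /=.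
      by case: (ltnP 0 i) => //= ?; case: (ltnP 0 k) => //= ?; rewrite !posE.
    over.
  exact: Hb.
(* One null set for each code [m] of a list of digits; a code that decodes to nothing imposes no
   condition. *)
have ae_l m : {ae mu, forall x : g_sigma_algebraType (disks absv q),
    forall l : seq nat,
    unpickle m = Some l -> disk absv a0 (q%:R ^ k0) x -> forall j : nat,
    (fun N => (\sum_(1 <= n < N.+1) \1_(@level R F absv pi q C a0 k0
       (digits_val pi C l) (f (pos n)) j) x) / N%:R) @ \oo -->
      (q%:R ^ (- j%:Z) : R)}.
  case: (unpickle m) => [l|]; last exact: nearW.
  apply: filterS (ae_level_freq HF mu_transl mu_O (digits_val_le1 HF l)
    (fun n => Hscal _ (pos0 n)) lamk0 fin) => x + _ [<-].
  exact.
apply: filterS (ae_foralln ae_l) => x Hx xO b k b1.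
(* The centre [b] is replaced by a listed one within [Q ^ (- k)]: by the ultrametric inequality the
   two disks of radius [Q ^ (- k)] coincide, so the counts agree exactly. *)
have [l bl] := digits_val_dense HF k b1.
have := Hx (pickle l) l (pickleK l) xO k; rewrite -exprnN.
apply: cvg_trans; apply: near_eq_cvg; apply: nearW => N.
congr (_ / _).
rewrite (card_near_sum absv (fun n => intpart absv pi C (f n x))).
rewrite big_nat [RHS]big_nat; apply: eq_bigr => n /andP[n0 _].
rewrite posE // indicE; congr (nat_of_bool _)%:R.
apply/idP/idP => [/set_mem[_ H]|H].
  set u := intpart _ _ _ _ in H *.
  have -> : u - b = (u - digits_val pi C l) - (b - digits_val pi C l) by ring.
  by rewrite exprnN; exact: absB_le HF _ _ _ _ _.
apply/mem_set; split=> //; set u := intpart _ _ _ _ in H *.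
have -> : u - digits_val pi C l = (u - b) + (b - digits_val pi C l) by ring.
by rewrite exprnN in H; exact: absD_le HF _ _ _ _ _.
Qed.
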